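(* There is an absolute constant $c>0$ such that for every sufficiently large integer $n$ there exists a partial concept class $\mathbb{H}_n\subseteq\{0,1,\star\}^{[n]}$ with $\mathrm{LD}(\mathbb{H}_n)\le 2$ such that every disambiguation $\overline{\mathbb{H}}$ of $\mathbb{H}_n$ satisfies $\mathrm{LD}(\overline{\mathbb{H}})\ge \mathrm{VC}(\overline{\mathbb{H}})\ge c\log\log n$. Consequently, for the domain $\mathcal{X}=\mathbb{N}$ there exists a partial concept class $\mathbb{H}_\infty\subseteq\{0,1,\star\}^{\mathbb{N}}$ with $\mathrm{LD}(\mathbb{H}_\infty)\le 2$ such that every disambiguation $\overline{\mathbb{H}}$ of $\mathbb{H}_\infty$ satisfies $\mathrm{LD}(\overline{\mathbb{H}})\ge\mathrm{VC}(\overline{\mathbb{H}})=\infty$.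
   Context: A partial concept class on a domain $\mathcal{X}$ is a set $\mathbb{H}\subseteq\{0,1,\star\}^{\mathcal{X}}$ of functions $h:\mathcal{X}\to\{0,1,\star\}$; it is total if all functions take values in $\{0,1\}$. A finite set $\{x_1,\dots,x_d\}\subseteq\mathcal{X}$ is shattered by $\mathbb{H}$ if for every $y\in\{0,1\}^d$ there is $h\in\mathbb{H}$ with $h(x_i)=y_i$ for all $i$; $\mathrm{VC}(\mathbb{H})$ is the largest size of a shattered set ($\infty$ if unbounded). Consider a full binary tree of height $d$ whose internal nodes are indexed by strings $v\in\bigcup_{k=0}^{d-1}\{0,1\}^k$ (root = empty string, children of $v$ are $v0,v1$) and labelled by points $x_v\in\mathcal{X}$; it is shattered by $\mathbb{H}$ if for every $y\in\{0,1\}^d$ there is $h\in\mathbb{H}$ with $h(x_{y_1\cdots y_{i-1}})=y_i$ for all $i\in[d]$. The Littlestone dimension $\mathrm{LD}(\mathbb{H})$ is the largest $d$ for which such a shattered tree exists ($\infty$ if unbounded). A disambiguation of $\mathbb{H}$ is a total class $\overline{\mathbb{H}}\subseteq\{0,1\}^{\mathcal{X}}$ such that for every $h\in\mathbb{H}$ and every finite $S\subseteq h^{-1}(\{0,1\})$ there is $\bar h\in\overline{\mathbb{H}}$ agreeing with $h$ on $S$ (for finite $\mathcal{X}$ this means: for every $h\in\mathbb{H}$ some $\bar h\in\overline{\mathbb{H}}$ agrees with $h$ on all of $h^{-1}(\{0,1\})$). $[n]=\{1,\dots,n\}$. *)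

(* Defs.v *)
From Stdlib Require Import Reals.
From mathcomp Require Import all_boot.
Set Implicit Arguments. Unset Strict Implicit. Unset Printing Implicit Defensive.

(* A partial concept h : X -> {0,1,*} is encoded as X -> option bool,
   with None = star and Some b = b.  A (partial) concept class is a
   predicate on such functions; a total class is a predicate on X -> bool. *)
Definition partial_class (X : Type) := (X -> option bool) -> Prop.
Definition total_class (X : Type) := (X -> bool) -> Prop.

Definition as_partial (X : Type) (Hb : total_class X) : partial_class X :=
  fun h => exists g, Hb g /\ forall x, h x = Some (g x).

Definition shatters (X : eqType) (H : partial_class X) (s : seq X) : Prop :=
  forall y : X -> bool, exists h, H h /\ forall x, x \in s -> h x = Some (y x).

Definition VC_ge (X : eqType) (H : partial_class X) (d : nat) : Prop :=
  exists s : seq X, uniq s /\ (d <= size s)%N /\ shatters H s.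

Definition VC_ge_real (X : eqType) (H : partial_class X) (r : R) : Prop :=
  exists d : nat, VC_ge H d /\ Rle r (INR d).

Definition VC_infinite (X : eqType) (H : partial_class X) : Prop :=
  forall d : nat, VC_ge H d.

(* A full binary tree of height d with internal nodes indexed by bit strings
   v of length < d and labelled by t v; it is shattered by H if every branch
   y in {0,1}^d is realised by some h in H. *)
Definition tree_shattered (X : Type) (H : partial_class X)
    (t : seq bool -> X) (d : nat) : Prop :=
  forall y : seq bool, size y = d ->
    exists h, H h /\ forall i, (i < d)%N -> h (t (take i y)) = Some (nth false y i).

Definition LD_le (X : Type) (H : partial_class X) (d : nat) : Prop :=
  forall (d' : nat) (t : seq bool -> X), tree_shattered H t d' -> (d' <= d)%N.

Definition LD_ge (X : Type) (H : partial_class X) (d : nat) : Prop :=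
  exists (d' : nat) (t : seq bool -> X), (d <= d')%N /\ tree_shattered H t d'.

Definition LD_ge_VC (X : eqType) (H : partial_class X) : Prop :=
  forall d : nat, VC_ge H d -> LD_ge H d.

Definition disambiguation (X : eqType) (H : partial_class X) (Hb : total_class X)
  : Prop :=
  forall h, H h -> forall S : seq X, (forall x, x \in S -> h x <> None) ->
    exists g, Hb g /\ forall x, x \in S -> h x = Some (g x).

(* Main.v *)
Require Import Defs.
From Stdlib Require Import Reals.
From Stdlib Require Lra.
From mathcomp Require Import all_boot all_order all_algebra ring lra zify.

(* The class comes from an unambiguous DNF composed with an inner-product gadget.
   Terms [(v, p)] read an array [z] of [g ^ 3] bits, and at most one term accepts a
   given [z].  Points are arrays [a] over the alphabet [{0,1}^t]; two points [a], [b]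
   give [z c := hb (a c) (b c)], with [hb] a Hadamard matrix vanishing on the diagonal.
   A concept is a short term [(v, p)] with a pattern on its cells: it is [0] on the
   points [a] carrying the pattern and [1] on the points [b] for which the pattern
   and [b] make the term accept.  Unambiguity says that [h u = 0] and [h v = 1]
   determine [h], so no tree of height 3 is shattered.

   In a disambiguation, a set of points with equal columns contains no pair [a], [b]
   making a short term accept.  Such a set has density at most [2 ^ - g ^ 2]:
   otherwise restrict it to a subset fixed on fewer than [g ^ 2] cells and spread on
   all others, take a term that needs no [1] on the fixed cells, and find the pair by
   Fourier analysis.  So there are at least [2 ^ (g ^ 2)] distinct columns, against
   [2 ^ O(g log g)] concepts; Sauer-Shelah gives dual VC dimension [g ^ Omega(1)],
   hence VC dimension [Omega(log g)], while the number of points is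
   [2 ^ (g ^ O(1))]. *)

Set Implicit Arguments. Unset Strict Implicit. Unset Printing Implicit Defensive.
Import Order.TTheory GRing.Theory Num.Theory.
Local Open Scope ring_scope.

(** * Fourier analysis on arrays over an alphabet with an orthogonal sign matrix *)

Lemma sum_sqr_le (I : finType) (P : pred I) (G : I -> rat) :
  (\sum_(a | P a) G a) ^+ 2 <= #|P|%:R * \sum_(a | P a) G a ^+ 2.
Proof.
have: 0 <= \sum_(a | P a) \sum_(b | P b) (G a - G b) ^+ 2.
  by apply: sumr_ge0 => a _; apply: sumr_ge0 => b _; rewrite sqr_ge0.
have -> : \sum_(a | P a) \sum_(b | P b) (G a - G b) ^+ 2 =
   2 * (#|P|%:R * \sum_(a | P a) G a ^+ 2) - 2 * (\sum_(a | P a) G a) ^+ 2.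
  transitivity (\sum_(a | P a) (#|P|%:R * G a ^+ 2 + \sum_(b | P b) G b ^+ 2
     - 2 * (G a * \sum_(b | P b) G b))).
    apply: eq_bigr => a _; rewrite !mulr_sumr -sumr_const.
    rewrite mulr_suml -!big_split /= -sumrN -big_split /=.
    by apply: eq_bigr => b _; ring.
  rewrite sumrB big_split /= -mulr_sumr sumr_const -mulr_sumr -mulr_suml.
  by rewrite -mulr_natl; ring.
lra.
Qed.

Section Spread.
Variables (C E : finType) (chi : E -> E -> rat).
Hypothesis chi_sqr : forall A B, chi A B ^+ 2 = 1.
Hypothesis chi_orth : forall B B',
  \sum_A chi A B * chi A B' = #|E|%:R * (B == B')%:R.
Local Notation V := {ffun C -> E}.
Local Notation q := (#|E|%:R : rat).

Definition agree (J : {set C}) (a b : V) := [forall c in J, a c == b c].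

Lemma agree_natr J (a b : V) :
  (agree J a b)%:R = \prod_(c in J) (a c == b c)%:R :> rat.
Proof.
have [/forall_inP ab|] := boolP (agree J a b).
  by rewrite big1 // => c /ab ->.
rewrite negb_forall_in => /exists_inP[c cJ abc].
by rewrite (bigD1 c) //= (negPf abc) mul0r.
Qed.

Lemma prodr_in_const (J : {set C}) (x : rat) :
  \prod_c (if c \in J then x else 1) = x ^+ #|J|.
Proof. by rewrite -big_mkcond prodr_const. Qed.

(** The sum factors over cells: a cell of [J] contributes 1, any other cell [q]. The factor
    [q ^+ #|J|] avoids a division. *)
Lemma sum_agree J (a : V) :
  (\sum_b (agree J a b)%:R) * q ^+ #|J| = q ^+ #|C|.
Proof.
under eq_bigr do rewrite agree_natr big_mkcond /=.
rewrite -(bigA_distr_bigA (fun c A => if c \in J then (a c == A)%:R else 1)) /=.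
rewrite -prodr_in_const -big_split /= -prodr_const; apply: eq_bigr => c _.
case: ifP => _; last by rewrite sumr_const mulr1.
by rewrite (bigD1 (a c)) //= eqxx big1 ?addr0 ?mul1r // => A /negPf;
   rewrite eq_sym => ->.
Qed.

Definition chiJ (J : {set C}) (a b : V) := \prod_(c in J) chi (a c) (b c).

Lemma chiJ_orth J (b b' : V) :
  \sum_a chiJ J a b * chiJ J a b' = q ^+ #|C| * (agree J b b')%:R.
Proof.
under eq_bigr do rewrite -big_split /= big_mkcond /=.
rewrite -(bigA_distr_bigA
  (fun c A => if c \in J then chi A (b c) * chi A (b' c) else 1)) /=.
rewrite agree_natr [X in _ * X]big_mkcond -prodr_const -big_split /=.
apply: eq_bigr => c _; case: ifP => _; first exact: chi_orth.
by rewrite sumr_const mulr1.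
Qed.

Lemma chiJ_agree J (a a' b : V) : agree J a a' -> chiJ J a b = chiJ J a' b.
Proof. by move/forall_inP => aa; apply: eq_bigr => c /aa /eqP ->. Qed.

(** A Lindsey-type bound. Cauchy-Schwarz passes to the sum of [G a ^+ 2] over [S], the bound [M]
    compares this with the sum over all arrays, and orthogonality evaluates the latter. *)
Lemma bilinear_bound (S : {set V}) (J : {set C}) (M : rat) :
  (0 < #|E|)%N ->
  (forall a, \sum_(b in S) (agree J b a)%:R <= M) ->
  (\sum_(a in S) \sum_(b in S) chiJ J a b) ^+ 2 <= (#|S|%:R * M) ^+ 2 * q ^+ #|J|.
Proof.
move=> E0 hM; have q0 : 0 < q by rewrite ltr0n.
set G := fun a => \sum_(b in S) chiJ J a b.
have M0 : 0 <= M.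
  have /card_gt0P[e _] := E0.
  by apply: le_trans (hM [ffun=> e]); apply: sumr_ge0 => b _; rewrite ler0n.
have sumG : \sum_a G a ^+ 2 <= q ^+ #|C| * (#|S|%:R * M).
  have -> : \sum_a G a ^+ 2 = \sum_(b in S) \sum_(b' in S) q ^+ #|C| * (agree J b b')%:R.
    under eq_bigr do rewrite expr2 mulr_suml.
    rewrite exchange_big; apply: eq_bigr => b _ /=.
    under eq_bigr do rewrite mulr_sumr.
    by rewrite exchange_big; apply: eq_bigr => b' _ /=; rewrite chiJ_orth.
  rewrite exchange_big /=; under eq_bigr do rewrite -mulr_sumr.
  rewrite -mulr_sumr ler_pM2l ?exprn_gt0 // -[#|S|%:R]sumr_const mulr_suml.
  by apply: ler_sum => b _; rewrite mul1r.
have sumSG : (\sum_(a in S) G a ^+ 2) * q ^+ #|C| <= M * q ^+ #|J| * \sum_a G a ^+ 2.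
  have -> : (\sum_(a in S) G a ^+ 2) * q ^+ #|C| =
     q ^+ #|J| * \sum_b (\sum_(a in S) (agree J a b)%:R) * G b ^+ 2.
    under [in RHS]eq_bigr do rewrite mulr_suml.
    rewrite exchange_big /= mulr_suml mulr_sumr; apply: eq_bigr => a _.
    rewrite -(sum_agree J a) mulrA mulrC mulr_sumr; congr (_ * _).
    apply: eq_bigr => b _; have [ab|] := boolP (agree J a b); last by rewrite mulr0 mul0r.
    by rewrite mulrC /G; under eq_bigr do rewrite (chiJ_agree _ ab).
  rewrite [M * _]mulrC -mulrA ler_pM2l ?exprn_gt0 // mulr_sumr.
  by apply: ler_sum => b _; rewrite ler_wpM2r ?sqr_ge0.
have := sum_sqr_le (mem S) G; rewrite -/G => CS.
rewrite -(ler_pM2r (exprn_gt0 #|C| q0)).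
apply: (le_trans (ler_wpM2r (ltW (exprn_gt0 #|C| q0)) CS)).
rewrite -mulrA; apply: (@le_trans _ _ (#|S|%:R * (M * q ^+ #|J| * (q ^+ #|C| * (#|S|%:R * M))))).
  rewrite ler_wpM2l ?ler0n //; apply: (le_trans sumSG).
  by rewrite ler_wpM2l // mulr_ge0 // ltW ?exprn_gt0.
by rewrite le_eqVlt; apply/orP; left; apply/eqP; ring.
Qed.

(* Expanding [prod_(c in D) (1 + sgn c * chi c)] over subsets [J] of [D], the
   empty [J] contributes [#|S|^2] and the others together strictly less. *)
Lemma spread_hits (S : {set V}) (D : {set C}) (sgn : C -> rat) (L : rat) :
  (forall c, sgn c ^+ 2 = 1) -> (0 < #|S|)%N -> 0 < L ->
  (forall J : {set C}, J \subset D ->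
     `|\sum_(a in S) \sum_(b in S) chiJ J a b| * L ^+ #|J| <= #|S|%:R ^+ 2) ->
  (1 + L^-1) ^+ #|D| < 2 ->
  exists a b, [/\ a \in S, b \in S & forall c, c \in D -> chi (a c) (b c) = sgn c].
Proof.
move=> sg S0 L0 hX hL.
set N := #|S|%:R : rat; have N0 : 0 < N ^+ 2 by rewrite exprn_gt0 ?ltr0n.
pose X J := \sum_(a in S) \sum_(b in S) chiJ J a b.
(* Each factor is [0] or [2], so [F a b] is nonzero exactly when the pair realises [sgn] on all of
   [D]. *)
pose F (a b : V) := \prod_(c in D) (1 + sgn c * chi (a c) (b c)) : rat.
have [ab|none] := boolP [exists a in S, exists b in S, F a b != 0].
  have /exists_inP[a aS /exists_inP[b bS /prodf_neq0 Fab]] := ab.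
  exists a, b; split=> // c /Fab Fc.
  have /eqP := chi_sqr (a c) (b c); rewrite -subr_eq0 subr_sqr_1 mulf_eq0.
  have /eqP := sg c; rewrite -subr_eq0 subr_sqr_1 mulf_eq0 !subr_eq0 !addr_eq0.
  by case/orP=> /eqP s1 /orP[] /eqP c1; move: Fc; rewrite c1 s1 ?mul1r ?mulr1 ?mulrN1 ?mulN1r ?opprK ?subrr ?eqxx.
have F0 : \sum_(a in S) \sum_(b in S) F a b = 0.
  apply: big1 => a aS; apply: big1 => b bS; apply/eqP/negPn.
  move: none; rewrite negb_exists_in => /forall_inP/(_ a aS).
  by rewrite negb_exists_in => /forall_inP/(_ b bS).
pose x c := if c \in D then sgn c else 0.
pose y c := if c \in D then L^-1 else 0 : rat.
have FE (a b : V) : F a b = \sum_(J : {set C}) (\prod_(c in J) x c) * chiJ J a b.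
  rewrite /F big_mkcond /=.
  transitivity (\prod_c (x c * chi (a c) (b c) + 1)).
    by apply: eq_bigr => c _; rewrite /x; case: ifP => _; rewrite ?mul0r ?add0r // addrC.
  rewrite bigA_distr; apply: eq_bigr => J _.
  by rewrite -big_split [RHS]big_mkcond.
have sumE : \sum_(J : {set C}) (\prod_(c in J) x c) * X J = 0.
  rewrite -[RHS]F0.
  transitivity (\sum_(a in S) \sum_(b in S)
      \sum_(J : {set C}) (\prod_(c in J) x c) * chiJ J a b); last first.
    by apply: eq_bigr => a _; apply: eq_bigr => b _; rewrite FE.
  under [RHS]eq_bigr do rewrite exchange_big /=.
  rewrite exchange_big; apply: eq_bigr => J _; rewrite mulr_sumr.
  by apply: eq_bigr => a _; rewrite mulr_sumr.
have X0 : X set0 = N ^+ 2.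
  rewrite /X /chiJ; under eq_bigr => a _ do (under eq_bigr => b _ do rewrite big_set0; rewrite sumr_const).
  by rewrite sumr_const -mulr_natl expr2.
have yE : \sum_(J : {set C}) \prod_(c in J) y c = (1 + L^-1) ^+ #|D|.
  transitivity (\prod_c (y c + 1)).
    by rewrite bigA_distr; apply: eq_bigr => J _; rewrite big_mkcond.
  rewrite -prodr_in_const; apply: eq_bigr => c _.
  by rewrite /y; case: ifP => _; rewrite ?add0r // addrC.
have bd (J : {set C}) : `|(\prod_(c in J) x c) * X J| <= N ^+ 2 * \prod_(c in J) y c.
  have [JD|] := boolP (J \subset D); last first.
    case/subsetPn=> c cJ /negPf cD.
    by rewrite (bigD1 c) //= [in leRHS](bigD1 c) //= /x /y cD !(mul0r,mulr0) normr0.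
  have -> : \prod_(c in J) y c = (L ^+ #|J|)^-1.
    rewrite -exprVn -prodr_const; apply: eq_bigr => c cJ.
    by rewrite /y (subsetP JD).
  rewrite ler_pdivlMr ?exprn_gt0 // normrM normr_prod big1 ?mul1r ?hX // => c cJ.
  rewrite /x (subsetP JD) //; apply/eqP; rewrite -sqrp_eq1 ?normr_ge0 //.
  by rewrite real_normK ?sg ?num_real.
move: sumE; rewrite (bigD1 set0) //= big_set0 mul1r X0.
move: yE; rewrite (bigD1 set0) //= big_set0.
set W := \sum_(_ | _) _ => WE; set U := \sum_(_ | _) _ => UE.
have UW : `|U| <= N ^+ 2 * W.
  rewrite mulr_sumr; apply: le_trans (ler_norm_sum _ _ _) _.
  by apply: ler_sum => J _; exact: bd.
have W1 : W < 1 by lra.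
have : `|U| < N ^+ 2 by apply: (le_lt_trans UW); rewrite -[ltRHS]mulr1 ltr_pM2l.
have -> : U = - N ^+ 2 by lra.
by rewrite normrN ger0_norm ?ltxx // ltW.
Qed.
End Spread.

(** * Restriction to a spread subset *)

(** Fix cells greedily: take [(Q, e)] maximising the density gain discounted by a factor 2 per fixed
    cell. Comparison with the empty restriction bounds [#|Q|]; comparison with [J :|: Q] gives the
    spread condition. *)
Lemma exists_spread_restriction (C E : finType) (S : {set {ffun C -> E}}) (r : nat) :
  (0 < #|E|)%N -> (#|E| ^ #|C| < #|S| * 2 ^ r)%N ->
  exists (Q : {set C}) (S' : {set {ffun C -> E}}),
  [/\ (#|Q| < r)%N, S' \subset S, (0 < #|S'|)%N,
      {in S' &, forall (a b : {ffun C -> E}) c, c \in Q -> a c = b c} &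
      forall (J : {set C}) a, [disjoint J & Q] ->
        (#|[set b in S' | agree J b a]| * #|E| ^ #|J| <= #|S'| * 2 ^ #|J|)%N].
Proof.
move=> E0 hS; set m := #|C|.
have S0 : (0 < #|S|)%N by case: #|S| hS.
have /card_gt0P[e0 e0S] := S0.
pose R Q e := [set a in S | agree Q a e].
(* The discount [2 ^ - #|x.1|] is scaled by [2 ^ m] to stay in the natural numbers. *)
pose f (x : {set C} * {ffun C -> E}) :=
  (#|R x.1 x.2| * #|E| ^ #|x.1| * 2 ^ (m - #|x.1|))%N.
have [[Q e] _ maxf] := @arg_maxnP _ (set0, e0) xpredT f isT.
have f0 : (#|S| * 2 ^ m <= f (Q, e))%N.
  apply: leq_trans (maxf (set0, e0) isT); rewrite /f /= cards0 subn0 muln1.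
  rewrite leq_pmul2r ?expn_gt0 //; apply: subset_leq_card.
  by apply/subsetP => a aS; rewrite inE aS; apply/forall_inP => c; rewrite inE.
have Qm : (#|Q| <= m)%N by apply: max_card.
have cntQ : (#|R Q e| * #|E| ^ #|Q| <= #|E| ^ m)%N.
  have -> : (#|E| ^ m = #|[set a | agree Q a e]| * #|E| ^ #|Q|)%N.
    apply/eqP; rewrite -(eqr_nat rat) natrM !natrX -(sum_agree Q e) -[#|[set a | _]|]sum1_card natr_sum.
    rewrite [in X in _ == X]big_mkcond /=; apply/eqP; congr (_ * _); apply: eq_bigr => a _; rewrite inE.
    have -> : agree Q e a = agree Q a e.
      by apply: eq_forallb_in => c _; rewrite eq_sym.
    by case: (agree _ _ _).
  rewrite leq_mul2r subset_leq_card ?orbT //; apply/subsetP => a.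
  by rewrite !inE => /andP[].
have RQ0 : (0 < #|R Q e|)%N.
  case E1 : #|R Q e| f0 => [|//]; rewrite /f /= E1 !mul0n leqn0 muln_eq0 expn_eq0 /=.
  by rewrite orbF => /eqP h; rewrite h in S0.
exists Q, (R Q e); split=> //.
- have : (#|S| * 2 ^ m < #|S| * 2 ^ (r + (m - #|Q|)))%N.
    apply: (leq_ltn_trans f0); rewrite /f /= expnD mulnA.
    by rewrite ltn_pmul2r ?expn_gt0 // (leq_ltn_trans cntQ).
  by rewrite ltn_pmul2l // ltn_exp2l //; lia.
- by apply/subsetP => a; rewrite inE => /andP[].
- move=> a b; rewrite !inE => /andP[_ /forall_inP ha] /andP[_ /forall_inP hb] c cQ.
  by rewrite (eqP (ha c cQ)) (eqP (hb c cQ)).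
move=> J a JQ; pose e' : {ffun C -> E} := [ffun c => if c \in Q then e c else a c].
have cJQ : #|J :|: Q| = (#|J| + #|Q|)%N.
  by rewrite cardsU (eqP (_ : J :&: Q == set0)) ?cards0 ?subn0 // setI_eq0.
have JQm : (#|J| + #|Q| <= m)%N by rewrite -cJQ max_card.
have := maxf (J :|: Q, e') isT; rewrite /f /= cJQ.
have -> : R (J :|: Q) e' = [set b in R Q e | agree J b a].
  apply/setP => b; rewrite !inE -andbA; congr (_ && _).
  apply/forall_inP/andP => [h|[/forall_inP h1 /forall_inP h2] c].
    split; apply/forall_inP => c cJ; have := h c; rewrite inE cJ ?orbT ffunE => /(_ isT).
      by rewrite cJ.
    by rewrite (disjointFr JQ cJ).
  rewrite inE ffunE; case: ifP => [cQ _|_ /orP[|//]]; first exact: h1.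
  exact: h2.
rewrite (_ : m - #|Q| = (m - (#|J| + #|Q|)) + #|J|)%N; last by lia.
rewrite !expnD => h.
have p0 : (0 < #|E| ^ #|Q| * 2 ^ (m - (#|J| + #|Q|)))%N.
  by rewrite muln_gt0 !expn_gt0 E0.
rewrite -(leq_pmul2r p0); move: h; congr (_ <= _)%N; first by ring.
by rewrite mulnACA mulnAC !mulnA; congr (_ * _)%N; rewrite mulnAC.
Qed.

(** * The Hadamard gadget and realising patterns on spread sets *)

Section Hadamard.
Variable t : nat.
Local Notation E := {ffun 'I_t -> bool}.

(** The inner product mod 2 of [A] with the complement of [B]; complementing keeps the rows
    orthogonal and makes the diagonal vanish. *)
Definition hb (A B : E) := odd (\sum_i (A i && ~~ B i)).
Definition hsign (A B : E) : rat := (-1) ^+ hb A B.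

Lemma hb_diag A : hb A A = false.
Proof. by rewrite /hb big1 // => i _; rewrite andbN. Qed.

Lemma hsign_sqr A B : hsign A B ^+ 2 = 1.
Proof. by rewrite sqrr_sign. Qed.

Lemma hsign_orth B B' :
  \sum_A hsign A B * hsign A B' = #|{: E}|%:R * (B == B')%:R.
Proof.
have hE A B1 : hsign A B1 = \prod_i (-1) ^+ (A i && ~~ B1 i).
  by rewrite /hsign /hb signr_odd expr_sum.
under eq_bigr do rewrite !hE -big_split /=.
rewrite -(bigA_distr_bigA (fun i (x : bool) => (-1) ^+ (x && ~~ B i) * (-1) ^+ (x && ~~ B' i) : rat)) /=.
transitivity (\prod_i (2 * (B i == B' i)%:R : rat)).
  apply: eq_bigr => i _; rewrite big_bool /=.
  by case: (B i); case: (B' i).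
rewrite big_split /= prodr_const card_ffun card_bool natrX; congr (_ * _).
have [->|] := eqVneq B B'; first by rewrite big1 // => i _; rewrite eqxx.
case: (pickP (fun i => B i != B' i)) => [i Bi _|BB'].
  by rewrite (bigD1 i) //= (negPf Bi) mul0r.
by case/eqP; apply/ffunP => i; apply/eqP; rewrite -[_ == _]negbK BB'.
Qed.
End Hadamard.

(** By induction [(1 + L^-1) ^+ k * (L - k) <= L], and [L - k] exceeds [L / 2]. *)
Lemma bernoulli_inv (L : rat) (k : nat) :
  0 < L -> k%:R * 2 < L -> (1 + L^-1) ^+ k < 2.
Proof.
move=> L0 hk.
suff H : (1 + L^-1) ^+ k * (L - k%:R) <= L.
  have k0 : 0 <= k%:R :> rat by rewrite ler0n.
  have : (1 + L^-1) ^+ k * (L - k%:R) < 2 * (L - k%:R) by lra.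
  by rewrite ltr_pM2r //; lra.
elim: k {hk} => [|k IH]; first by rewrite mul1r subr0.
apply: le_trans IH; rewrite exprSr -mulrA ler_wpM2l ?exprn_ge0 ?addr_ge0 ?invr_ge0 ?ltW //.
have -> : (1 + L^-1) * (L - k.+1%:R) = (L - k%:R) - k.+1%:R * L^-1.
  by rewrite -natr1; field; rewrite gt_eqF.
by rewrite gtrBl mulr_gt0 ?ltr0n ?invr_gt0.
Qed.

(** The alphabet has size [4 * L ^+ 2] with [L = 2 ^+ tau]: the 4 cancels the spread loss of 2 per
    cell, which enters [bilinear_bound] squared, and what is left is the decay [L ^- #|J|] that
    [spread_hits] needs. *)
Lemma spread_pattern (C : finType) (tau : nat)
    (S : {set {ffun C -> {ffun 'I_(tau.+1 * 2) -> bool}}}) (D : {set C}) (tg : C -> bool) :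
  (0 < #|S|)%N -> (#|D| * 2 < 2 ^ tau)%N ->
  (forall (J : {set C}) a, J \subset D ->
     (#|[set b in S | agree J b a]| * (2 ^ (tau.+1 * 2)) ^ #|J| <= #|S| * 2 ^ #|J|)%N) ->
  exists a b, [/\ a \in S, b \in S & forall c, c \in D -> hb (a c) (b c) = tg c].
Proof.
move=> S0 hD spread; set L : rat := 2 ^+ tau.
have L0 : 0 < L by rewrite exprn_gt0.
have cE : #|{: {ffun 'I_(tau.+1 * 2) -> bool}}| = (2 ^ (tau.+1 * 2))%N.
  by rewrite card_ffun card_bool card_ord.
have [|||||a [b [aS bS ab]]] := @spread_hits C _ _ (@hsign_sqr _) S D (fun c => (-1) ^+ tg c) L.
- by move=> c; rewrite sqrr_sign.
- by [].
- by [].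
- move=> J JD.
  set q := (2 ^ (tau.+1 * 2))%N%:R : rat.
  have q0 : 0 < q by rewrite ltr0n expn_gt0.
  have qL : q = 4 * L ^+ 2 by rewrite /q /L natrX exprM (exprS _ tau); ring.
  have hM a : \sum_(b in S) (agree J b a)%:R <= #|S|%:R * 2 ^+ #|J| / q ^+ #|J|.
    rewrite ler_pdivlMr ?exprn_gt0 //.
    have := spread J a JD; rewrite -(ler_nat rat) !natrM !natrX => h.
    apply: le_trans h; rewrite /q !natrX ler_pM2r ?exprn_gt0 //.
    rewrite -natr_sum ler_nat -sum1_card big_mkcond [leqRHS]big_mkcond /=.
    by apply: leq_sum => b _; rewrite inE; case: (b \in S) => //; case: agree.
  have := bilinear_bound (@hsign_orth _) _ hM.
  rewrite cE expn_gt0 => /(_ isT).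
  set X := \sum_(a in S) _; rewrite -/q => hX.
  rewrite -[`|X| * _]ger0_norm ?mulr_ge0 ?exprn_ge0 ?(ltW L0) //.
  rewrite -[leRHS]ger0_norm ?exprn_ge0 ?ler0n // -ler_sqr ?qualifE /= ?normr_ge0 //.
  rewrite !real_normK ?num_real // exprMn real_normK ?num_real //.
  have LJ : 0 < (L ^+ #|J|) ^+ 2 by rewrite !exprn_gt0.
  apply: (le_trans (ler_wpM2r (ltW LJ) hX)).
  rewrite le_eqVlt; apply/orP; left; apply/eqP.
  have -> : q ^+ #|J| = (2 ^+ #|J|) ^+ 2 * (L ^+ #|J|) ^+ 2.
    by rewrite qL (_ : 4 = 2 ^+ 2) // exprMn exprAC [(L ^+ 2) ^+ _]exprAC.
  field; rewrite !expf_neq0 //; lra.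
- by apply: bernoulli_inv => //; rewrite -natrM /L -natrX ltr_nat.
by exists a, b; split=> // c /ab /signr_inj.
Qed.

(** * The unambiguous DNF *)

Section Terms.
Variable g : nat.
Local Notation C := ('I_g * 'I_g * 'I_g)%type.

(* For each ordered pair [(u, w)] there is a list of [g] cells.  The term [(v, p)]
   asserts that for every [w] the first [1] of list [(v, w)] is at position [p w],
   and that for every [u != v] list [(u, v)] has no [1] up to position [p u]. *)
Definition term_cells (v : 'I_g) (p : {ffun 'I_g -> 'I_g}) : {set C} :=
  [set c : C | (c.1.1 == v) && (c.2 <= p c.1.2)%N || (c.1.2 == v) && (c.2 <= p c.1.1)%N].

Definition term_value (v : 'I_g) (p : {ffun 'I_g -> 'I_g}) (c : C) :=
  (c.1.1 == v) && (c.2 == p c.1.2).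

Definition term_holds v p (z : C -> bool) :=
  [forall c in term_cells v p, z c == term_value v p c].

(* For [v != v'], the lists [(v, v')] and [(v', v)] would give [p' v < p v'] and
   [p v' < p' v]. *)
Lemma term_unique v p v' p' z :
  term_holds v p z -> term_holds v' p' z -> v = v' /\ p = p'.
Proof.
move=> /forall_inP h /forall_inP h'.
have first u r w (hr : {in term_cells u r, forall c, z c == term_value u r c}) :
    z (u, w, r w) /\ forall s : 'I_g, (s < r w)%N -> z (u, w, s) = false.
  split.
    have /hr/eqP -> : (u, w, r w) \in term_cells u r by rewrite inE /= eqxx leqnn.
    by rewrite /term_value /= !eqxx.
  move=> s sr; have /hr/eqP -> : (u, w, s) \in term_cells u r.
    by rewrite inE /= eqxx ltnW.
  rewrite /term_value /= eqxx /=; apply/negbTE/eqP => sE.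
  by rewrite sE ltnn in sr.
have col u r w (s : 'I_g) (hr : {in term_cells u r, forall c, z c == term_value u r c}) :
    w != u -> (s <= r w)%N -> z (w, u, s) = false.
  move=> wu sr; have /hr/eqP -> : (w, u, s) \in term_cells u r.
    by rewrite inE /= eqxx sr orbT.
  by rewrite /term_value /= (negPf wu).
have vv : v = v'.
  apply/eqP/negPn/negP => vv'.
  have [z1 _] := first _ _ v' h; have [z2 _] := first _ _ v h'.
  have lt1 : (p' v < p v')%N.
    by rewrite ltnNge; apply/negP => le; rewrite (col _ _ _ _ h' vv' le) in z1.
  have v'v : v' != v by rewrite eq_sym.
  have lt2 : (p v' < p' v)%N.
    by rewrite ltnNge; apply/negP => le; rewrite (col _ _ _ _ h v'v le) in z2.
  by move: (ltn_trans lt1 lt2); rewrite ltnn.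
split=> //; subst v'; apply/ffunP => w; apply/val_inj => /=.
have [z1 n1] := first _ _ w h; have [z2 n2] := first _ _ w h'.
case: (ltngtP (p w) (p' w)) => // lt; first by rewrite n2 in z1.
by rewrite n1 in z2.
Qed.

Lemma sum_ltn_ord n k : (\sum_(s < n) (s < k) = minn n k)%N.
Proof.
elim: n => [|n IH]; first by rewrite big_ord0 min0n.
by rewrite big_ord_recr /= IH; case: ltnP; lia.
Qed.

Lemma card_cells (P : pred C) :
  #|[set c | P c]| = (\sum_u \sum_w \sum_s P (u, w, s))%N.
Proof.
rewrite pair_bigA /= pair_bigA /= -sum1_card big_mkcond /=.
by apply: eq_bigr => -[[u w] s] _; rewrite inE; case: (P _).
Qed.

Lemma card_term_cells v p :
  (#|term_cells v p| <= 2 * \sum_w (p w).+1)%N.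
Proof.
have half (P : 'I_g -> 'I_g -> 'I_g -> bool) :
    (forall u, u != v -> forall w s, P u w s = false) ->
    (forall w s, P v w s = (s <= p w)%N) ->
    (\sum_u \sum_w \sum_s P u w s <= \sum_w (p w).+1)%N.
  move=> h0 h1; rewrite (bigD1 v) //= [X in (_ + X)%N]big1 ?addn0.
    apply: leq_sum => w _.
    have -> : (\sum_s P v w s = \sum_(s < g) (s < (p w).+1))%N.
      by apply: eq_bigr => s _; rewrite h1.
    by rewrite sum_ltn_ord geq_minr.
  by move=> u uv; apply: big1 => w _; apply: big1 => s _; rewrite h0.
have -> : term_cells v p = [set c : C | (c.1.1 == v) && (c.2 <= p c.1.2)%N] :|:
    [set c : C | (c.1.2 == v) && (c.2 <= p c.1.1)%N].
  by apply/setP => c; rewrite !inE.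
apply: (leq_trans (leq_card_setU _ _)); rewrite mul2n -addnn !card_cells leq_add //.
  apply: half => [u /negPf uv w s|w s] /=; first by rewrite uv.
  by rewrite eqxx.
rewrite exchange_big /=.
apply: (half (fun w u s => (w == v) && (s <= p u)%N)) => [u /negPf uv w s|w s] //=.
  by rewrite uv.
by rewrite eqxx.
Qed.

(* Letting [p w] point to the first cell of list [(v, w)] outside [Q] puts no
   [1] of the term inside [Q] and keeps the term short. *)
Lemma short_term_avoiding (Q : {set C}) :
  (#|Q| < g * g)%N ->
  exists v p, (#|term_cells v p| <= 4 * g)%N /\
    {in Q, forall c, c \in term_cells v p -> term_value v p c = false}.
Proof.
move=> Qg.
pose n v w := (\sum_s ((v, w, s) \in Q))%N.
have cQ : #|Q| = (\sum_v \sum_w n v w)%N.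
  by rewrite -card_cells; congr #|pred_of_set _|; apply/setP => c; rewrite inE.
have [v vQ] : exists v, (\sum_w n v w < g)%N.
  apply/existsP; apply: contraTT Qg; rewrite negb_exists -leqNgt => /forallP h.
  rewrite cQ -{1}(card_ord g) -sum_nat_const; apply: leq_sum => v _.
  by rewrite leqNgt h.
have /fin_all_exists[p hp] w : exists s : 'I_g, (v, w, s) \notin Q /\
    forall s' : 'I_g, (s' < s)%N -> (v, w, s') \in Q.
  have [s0 s0Q] : exists s, (v, w, s) \notin Q.
    apply/existsP; apply: contraTT vQ; rewrite negb_exists -leqNgt => /forallP h.
    rewrite (bigD1 w) //=; apply: leq_trans (leq_addr _ _).
    rewrite /n; under eq_bigr do rewrite (negPn (h _)).
    by rewrite sum_nat_const card_ord muln1.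
  have [s sQ smin] := @arg_minnP _ s0 (fun s => (v, w, s) \notin Q) val s0Q.
  exists s; split=> // s' lt; apply/negPn/negP => /smin; rewrite leqNgt => /negP; exact.
exists v, [ffun w => p w]; split.
  apply: (leq_trans (card_term_cells _ _)).
  have : (\sum_w (p w) <= \sum_w n v w)%N.
    apply: leq_sum => w _.
    have <- : (\sum_(s < g) (s < p w) = p w)%N.
      by rewrite sum_ltn_ord; apply/minn_idPr/ltnW.
    by apply: leq_sum => s _; case: (ltnP s (p w)) => // /(hp w).2 ->.
  have -> : (\sum_w ([ffun w => p w] w : 'I_g).+1 = \sum_w (p w) + g)%N.
    under eq_bigr do rewrite ffunE -addn1.
    by rewrite big_split /= sum_nat_const card_ord muln1.
  lia.
move=> [[u w] s] cQ'; rewrite /term_value /= ffunE => _.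
apply/negbTE/negP => /andP[/eqP uv /eqP sp]; subst u s.
by have := (hp w).1; rewrite cQ'.
Qed.

(* [hb] vanishes on the diagonal, so the fixed cells [Q] satisfy the term for
   free and only the spread cells outside [Q] need [spread_pattern]. *)
Lemma matching_pair (tau : nat)
    (S : {set {ffun C -> {ffun 'I_(tau.+1 * 2) -> bool}}}) :
  (8 * g < 2 ^ tau)%N ->
  ((2 ^ (tau.+1 * 2)) ^ (g * g * g) < #|S| * 2 ^ (g * g))%N ->
  exists v p a b, [/\ a \in S, b \in S, (#|term_cells v p| <= 4 * g)%N &
    term_holds v p (fun c => hb (a c) (b c))].
Proof.
move=> hg hS.
have cE : #|{: {ffun 'I_(tau.+1 * 2) -> bool}}| = (2 ^ (tau.+1 * 2))%N.
  by rewrite card_ffun card_bool card_ord.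
have [||Q [S' [Qg S'S S'0 S'Q spread]]] := @exists_spread_restriction C _ S (g * g).
- by rewrite cE expn_gt0.
- by rewrite cE !card_prod card_ord.
have [v [p [Tg QT]]] := short_term_avoiding Qg.
have [|||a [b [aS bS ab]]] := @spread_pattern C tau S' (term_cells v p :\: Q) (term_value v p).
- by [].
- have : (#|term_cells v p :\: Q| <= 4 * g)%N.
    by apply: leq_trans Tg; apply/subset_leq_card/subsetDl.
  lia.
- move=> J a JD; rewrite -cE; apply: spread.
  by rewrite disjoint_subset; apply/subsetP => c /(subsetP JD); rewrite !inE => /andP[].
exists v, p, a, b; split=> //; try exact: (subsetP S'S).
apply/forall_inP => c cT; have [cQ|cQ] := boolP (c \in Q).
  by rewrite (S'Q a b) // hb_diag QT.
by rewrite ab // inE cQ.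
Qed.
End Terms.

(** * Sauer-Shelah and dual shattering *)

Definition set_shatters (X : finType) (F : {set {set X}}) (A : {set X}) :=
  [forall B : {set X}, (B \subset A) ==> [exists Y in F, Y :&: A == B]].

Lemma set_shattersP (X : finType) (F : {set {set X}}) (A : {set X}) :
  reflect (forall B : {set X}, B \subset A -> exists2 Y, Y \in F & Y :&: A = B)
    (set_shatters F A).
Proof.
apply: (iffP forallP) => [h B BA|h B].
  by have /implyP/(_ BA)/exists_inP[Y YF /eqP] := h B; exists Y.
by apply/implyP => /h[Y YF YB]; apply/exists_inP; exists Y; rewrite ?YB.
Qed.

(** Pajor's induction: split [F] by membership of a point [x]. Sets shattered by a half avoid [x]
    and are shattered by [F]; a set [A] shattered by both halves yields in addition [x |: A]. *)
Lemma pajor (X : finType) (F : {set {set X}}) :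
  (#|F| <= #|[set A | set_shatters F A]|)%N.
Proof.
have [n] := ubnP #|F|; elim: n F => // n IH F /ltnSE Fn.
have [F1|] := leqP #|F| 1.
  case: (posnP #|F|) => [->//|/card_gt0P[Y YF]].
  apply: (leq_trans F1); apply/card_gt0P; exists set0; rewrite inE.
  apply/set_shattersP => B; rewrite subset0 => /eqP ->.
  by exists Y; rewrite ?setI0.
case/card_gt1P=> Y0 [Y1 [Y0F Y1F Y01]].
have [x xY] : exists x, (x \in Y0) != (x \in Y1).
  apply/existsP; apply: contraTT Y01; rewrite negb_exists negbK => /forallP h.
  by apply/eqP/setP => x; apply/eqP; rewrite -[_ == _]negbK h.
pose G b := [set Y in F | (x \in Y) == b].
have Gsub b : G b \subset F by apply/subsetP => Y; rewrite inE => /andP[].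
have FG : (#|F| = #|G false| + #|G true|)%N.
  rewrite -cardsUI (_ : _ :&: _ = set0) ?cards0 ?addn0.
    by congr #|pred_of_set _|; apply/setP => Y; rewrite !inE; case: (x \in Y); rewrite ?andbF ?orbF ?andbT.
  by apply/setP => Y; rewrite !inE; case: (x \in Y); rewrite ?andbF.
have G0 b : (0 < #|G b|)%N.
  apply/card_gt0P; case E0 : (x \in Y0) xY; case E1 : (x \in Y1) => // _; case: b;
    solve [by exists Y0; rewrite inE Y0F E0 | by exists Y1; rewrite inE Y1F E1].
have Gn b : (#|G b| < n)%N.
  by apply: leq_trans Fn; rewrite FG; have := G0 false; have := G0 true; case: b; lia.
pose sh b := [set A | set_shatters (G b) A].
have shx b A : A \in sh b -> x \notin A.
  rewrite inE => /set_shattersP h; apply/negP => xA.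
  have [Y YG YA] := h (if b then A :\ x else A) ltac:(by case: b {h}; rewrite ?subD1set).
  move/setP/(_ x): YA; move: YG; rewrite !inE => /andP[_ /eqP ->]; rewrite xA.
  by case: b {h}; rewrite ?inE ?eqxx ?xA.
rewrite FG; apply: (leq_trans (leq_add (IH _ (Gn false)) (IH _ (Gn true)))).
rewrite -/(sh false) -/(sh true) -cardsUI.
(* Sets counted twice are recounted through [x |: A]; these images contain [x], so they are disjoint
   from the union. *)
have inj : {in sh false :&: sh true &, injective (fun A => x |: A)}.
  move=> A B; rewrite !in_setI => /andP[/shx xA _] /andP[/shx xB _] AB.
  by rewrite -(setU1K xA) AB setU1K.
rewrite -(card_in_imset inj).
set U := sh false :|: sh true; set W := [set _ | _ in _].
have UW : U :&: W = set0.
  apply/setP => A; rewrite in_set0 in_setI; apply/negP => /andP[AU /imsetP[B _ AB]].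
  have : x \notin A by move: AU; rewrite in_setU => /orP[] /shx.
  by rewrite AB setU11.
have -> : (#|U| + #|W| = #|U :|: W|)%N by rewrite -cardsUI UW cards0 addn0.
apply/subset_leq_card/subsetP => A; rewrite in_setU => /orP[].
  rewrite !inE => /orP[] /set_shattersP h; apply/set_shattersP => B /h[Y YG YA];
  by exists Y => //; apply: (subsetP (Gsub _)) YG.
case/imsetP=> A'; rewrite in_setI => /andP[A0 A1] ->{A}; have xA := shx _ _ A0.
rewrite inE; apply/set_shattersP => B BA.
have [Y YG YA] : exists2 Y, Y \in G (x \in B) & Y :&: A' = B :\ x.
  have BxA : B :\ x \subset A' by rewrite subDset.
  by move: A0 A1; rewrite !inE => /set_shattersP h0 /set_shattersP h1; case: (x \in B); [apply: h1|apply: h0].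
exists Y; first exact: (subsetP (Gsub _)) YG.
move: YG; rewrite inE => /andP[_ /eqP xYB].
apply/setP => z; rewrite !inE; have [->|zx] /= := eqVneq z x; first by rewrite andbT.
by move/setP/(_ z): YA; rewrite !inE zx.
Qed.

(** A set of at most [D] points is listed by a function on ['I_D], with [None] as padding. *)
Lemma card_small_sets (X : finType) (D : nat) :
  (#|[set A : {set X} | #|A| <= D]| <= #|X|.+1 ^ D)%N.
Proof.
pose f (u : {ffun 'I_D -> option X}) := [set x | Some x \in codom u].
have <- : #|{: {ffun 'I_D -> option X}}| = (#|X|.+1 ^ D)%N.
  by rewrite card_ffun card_option card_ord.
apply: leq_trans (leq_imset_card f _); apply/subset_leq_card/subsetP => A.
rewrite inE => AD; apply/imsetP; exists [ffun i : 'I_D => nth None (map Some (enum A)) i] => //.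
apply/setP => x; rewrite inE; apply/idP/codomP => [xA|[i]].
  have iD : (index x (enum A) < D)%N.
    by apply: leq_trans AD; rewrite cardE index_mem mem_enum.
  exists (Ordinal iD); rewrite ffunE /= (nth_map x) ?index_mem ?mem_enum //.
  by rewrite nth_index ?mem_enum.
rewrite ffunE; have [lt|ge] := ltnP i (size (enum A)); last by rewrite nth_default ?size_map.
by rewrite (nth_map x) // => -[->]; rewrite -mem_enum mem_nth.
Qed.

Lemma sauer_shelah (X : finType) (F : {set {set X}}) (D : nat) :
  (#|X|.+1 ^ D < #|F|)%N -> exists2 A, set_shatters F A & (D <= #|A|)%N.
Proof.
move=> FD; have /subsetPn[A] : ~~ ([set A | set_shatters F A] \subset [set A : {set X} | #|A| <= D]%N).
  apply: contraL FD => /subset_leq_card h; rewrite -leqNgt.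
  exact: leq_trans (pajor F) (leq_trans h (card_small_sets _ _)).
by rewrite !inE -ltnNge => hA /ltnW; exists A.
Qed.

(* A shattered set of [2 ^ d] rows, indexed by [{0,1}^d], has among its columns
   the [d] coordinate functions. *)
Lemma dual_shatter (Theta V : finType) (G : Theta -> V -> bool) (d : nat) :
  (#|Theta|.+1 ^ (2 ^ d) < #|[set [set th | G th a] | a : V]|)%N ->
  exists a : 'I_d -> V, injective a /\
    forall y : {ffun 'I_d -> bool}, exists th, forall j, G th (a j) = y j.
Proof.
case/sauer_shelah=> A /set_shattersP hA dA.
have cY : #|{: {ffun 'I_d -> bool}}| = (2 ^ d)%N by rewrite card_ffun card_bool card_ord.
have lt (y : {ffun 'I_d -> bool}) : (enum_rank y < #|A|)%N.
  by apply: leq_trans dA; rewrite -cY; apply: ltn_ord.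
pose iota (y : {ffun 'I_d -> bool}) := enum_val (Ordinal (lt y)).
have iotaI : injective iota.
  by move=> y y' /enum_val_inj [] /val_inj /enum_rank_inj.
have iotaA y : iota y \in A by apply: enum_valP.
have /fin_all_exists[a ha] j : exists a, forall y, G (iota y) a = y j.
  have [|Y /imsetP[a _ ->] YA] := hA [set iota y | y : {ffun 'I_d -> bool} & y j].
    by apply/subsetP => th /imsetP[y _ ->].
  exists a => y; move/setP/(_ (iota y)): YA; rewrite !inE iotaA andbT => ->.
  by rewrite mem_imset // inE.
exists a; split=> [j j' E|y]; last by exists (iota y).
have := ha j [ffun k => k == j]; rewrite E ha !ffunE eqxx.
by move/eqP.
Qed.

(** Points with the same column form a class with no separated pair, hence of density at most
    [1 / n]; the classes partition [V]. *)
Lemma many_columns (Theta V : finType) (G : Theta -> V -> bool) (n : nat) :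
  (0 < #|V|)%N ->
  (forall S : {set V}, (#|V| < #|S| * n)%N ->
     exists a b, [/\ a \in S, b \in S & exists th, G th a != G th b]) ->
  (n <= #|[set [set th | G th a] | a : V]|)%N.
Proof.
move=> V0 h; rewrite -(leq_pmul2l V0) -[in leqLHS]sum1_card.
pose col a := [set th | G th a].
rewrite (partition_big col (mem [set col a | a : V])) /=; last first.
  by move=> a _; apply: imset_f.
rewrite big_distrl /= mulnC -sum_nat_const; apply: leq_sum => c _.
rewrite sum1dep_card leqNgt; apply/negP => /h[a [b]].
rewrite !inE => -[/eqP ac /eqP bc [th]].
have := ac; rewrite -bc => /setP/(_ th); rewrite !inE => ->.
by rewrite eqxx.
Qed.

(** * The partial concepts and their parameters *)

Section Concepts.
Variables g t : nat.
Local Notation C := ('I_g * 'I_g * 'I_g)%type.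
Local Notation E := {ffun 'I_t -> bool}.
Local Notation V := {ffun C -> E}.
Local Notation Theta := ('I_g * {ffun 'I_g -> 'I_g} * (4 * g).-tuple E)%type.

(** The pattern is stored as a list along the enumeration of the term's cells, not as a whole array:
    this keeps the number of concepts at [2 ^ O(g log g)]. *)
Definition pattern (th : Theta) (c : C) : E :=
  nth [ffun=> false] th.2 (index c (enum (term_cells th.1.1 th.1.2))).

(** The two tests exclude each other: at the cell [(v, v, p v)] the term demands a 1, while [hb]
    vanishes when [a] carries the pattern. *)
Definition concept (th : Theta) (a : V) : option bool :=
  let: T := term_cells th.1.1 th.1.2 in
  if [forall c in T, a c == pattern th c] then Some false
  else if term_holds th.1.1 th.1.2 (fun c => hb (pattern th c) (a c)) then Some true
  else None.

(** Abstract unambiguity. The conclusion equates functions rather than indices, since tuples that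
    differ past the term's cells give the same concept. *)
Definition crosses_once (I X : Type) (h : I -> X -> option bool) :=
  forall i j u v, h i u = Some false -> h i v = Some true ->
    h j u = Some false -> h j v = Some true -> h i =1 h j.

(** The value 0 at [u] identifies the pattern with [u] on the cells, so the value 1 at [v] makes the
    term accept the array of the pair [(u, v)]. By [term_unique] this fixes the term, and then the
    pattern on its cells. *)
Lemma concept_crosses_once : crosses_once concept.
Proof.
have val th u v : concept th u = Some false -> concept th v = Some true ->
    {in term_cells th.1.1 th.1.2, u =1 pattern th} /\
    term_holds th.1.1 th.1.2 (fun c => hb (u c) (v c)).
  rewrite /concept; case: ifP => [/forall_inP hu _|_]; last by case: ifP.
  case: ifP => // _; case: ifP => // /forall_inP hv _; split.
    by move=> c /hu /eqP.
  by apply/forall_inP => c cT; rewrite (eqP (hu c cT)) hv.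
move=> [[v p] be] [[v' p'] be'] a b h1 h2 h1' h2'.
have [/= ab z] := val _ _ _ h1 h2; have [/= ab' z'] := val _ _ _ h1' h2'.
have [vv pp] := term_unique z z'; subst v' p' => x.
have eqp c : c \in term_cells v p -> pattern (v, p, be) c = pattern (v, p, be') c.
  by move=> cT; rewrite -ab // ab'.
rewrite /concept /=.
have -> : [forall c in term_cells v p, x c == pattern (v, p, be) c] =
    [forall c in term_cells v p, x c == pattern (v, p, be') c].
  by apply: eq_forallb_in => c /eqp ->.
suff -> : term_holds v p (fun c => hb (pattern (v, p, be) c) (x c)) =
    term_holds v p (fun c => hb (pattern (v, p, be') c) (x c)) by [].
by apply: eq_forallb_in => c /eqp ->.
Qed.

Lemma concept_separates v p (a b : V) :
  (#|term_cells v p| <= 4 * g)%N -> term_holds v p (fun c => hb (a c) (b c)) ->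
  exists th, concept th a = Some false /\ concept th b = Some true.
Proof.
move=> Tg /forall_inP z.
pose be := [tuple of mkseq (nth [ffun=> false] (map a (enum (term_cells v p)))) (4 * g)].
pose th : Theta := (v, p, be); exists th.
have patE c : c \in term_cells v p -> pattern th c = a c.
  move=> cT; have iT : (index c (enum (term_cells v p)) < #|term_cells v p|)%N.
    by rewrite cardE index_mem mem_enum.
  rewrite /pattern /= nth_mkseq ?(leq_trans iT) //.
  by rewrite (nth_map c) ?nth_index ?mem_enum // -cardE.
rewrite /concept /=; split.
  by rewrite (_ : [forall _ in _, _]) //; apply/forall_inP => c /patE ->.
rewrite (_ : [forall _ in _, _] = false).
  by rewrite (_ : term_holds _ _ _) //; apply/forall_inP => c cT; rewrite patE // z.
have cT : (v, v, p v) \in term_cells v p by rewrite inE /= eqxx leqnn.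
apply/negP => /forall_inP/(_ _ cT); rewrite patE // => /eqP ba.
by have := z _ cT; rewrite ba hb_diag /term_value /= !eqxx.
Qed.
End Concepts.

Lemma linear_lt_exp2 i : (8 <= i)%N -> (20 * i + 41 < 2 ^ i)%N.
Proof.
move=> /subnK <-; elim: (i - 8)%N => [//|k IH].
by rewrite addSn expnS; move: IH; set m := (2 ^ _)%N; lia.
Qed.

(** With [g = 4 ^ i], any total extension [G] has at least [2 ^ (g * g)] columns, more than the
    Sauer-Shelah bound for dual dimension [2 ^ i]. The choice of [tau] gives [2 ^ tau = 16 * g],
    above the required [8 * g]. *)
Lemma concept_dual_vc (i : nat) : (8 <= i)%N ->
  forall G : _ -> _ -> bool,
  (forall th a b, @concept (4 ^ i) ((2 * i + 4).+1 * 2) th a = Some b -> G th a = b) ->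
  exists a : 'I_i -> _, injective a /\
    forall y : {ffun 'I_i -> bool}, exists th, forall j, G th (a j) = y j.
Proof.
move=> i8 G hG; set g := (4 ^ i)%N in G hG *; set tau := (2 * i + 4)%N in G hG *.
have g2 : (g = 2 ^ i * 2 ^ i)%N by rewrite -expnMn.
have g0 : (0 < g)%N by rewrite expn_gt0.
apply: dual_shatter; apply: (@leq_trans (2 ^ (g * g))); last first.
  apply: many_columns.
    by rewrite !card_ffun card_bool !expn_gt0.
  move=> S hS; have [||v [p [a [b [aS bS Tg z]]]]] := @matching_pair g tau S.
  - rewrite /tau expnD expnM -/g; lia.
  - by move: hS; rewrite !card_ffun card_bool !card_prod !card_ord.
  exists a, b; split=> //; have [th [h0 h1]] := concept_separates Tg z.
  by exists th; rewrite (hG _ _ _ h0) (hG _ _ _ h1).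
rewrite !card_prod !card_ffun card_tuple card_ffun card_bool !card_ord.
have gE : (2 ^ (2 * i) = g)%N by rewrite expnM.
(* The number of concepts is [2 ^ e] with [e.+1 <= (20 * i + 41) * g]; as [g] is the square of
   [2 ^ i], [linear_lt_exp2] yields [e.+1 * 2 ^ i < g * g]. *)
pose e := (2 * i + 2 * i * g + tau.+1 * 2 * (4 * g))%N.
have -> : (g * g ^ g * (2 ^ (tau.+1 * 2)) ^ (4 * g) = 2 ^ e)%N.
  by rewrite /e 2!expnD (expnM 2 (2 * i) g) (expnM 2 (tau.+1 * 2)) gE.
have e0 : (0 < 2 ^ e)%N by rewrite expn_gt0.
apply: (@leq_ltn_trans ((2 ^ e.+1) ^ (2 ^ i))).
  rewrite leq_exp2r ?expn_gt0 // expnS mul2n -addnn; exact: (leq_add e0 (leqnn _)).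
have := linear_lt_exp2 i8; rewrite -expnM ltn_exp2l //.
move: g2 g0; set D := (2 ^ i)%N => gD g0 i41.
have : (e.+1 <= (20 * i + 41) * g)%N by rewrite /e /tau; nia.
rewrite -(leq_pmul2r (_ : 0 < D)%N); last by lia.
move=> h; apply: (leq_ltn_trans h).
by rewrite -mulnA [(g * D)%N]mulnC mulnA ltn_pmul2r // gD ltn_pmul2r; lia.
Qed.

(** In a tree of height at least 3, the branches starting 0,1,0 and 0,1,1 share a 0 and then a 1, so
    their concepts coincide and cannot differ at the third node. *)
Lemma crosses_once_LD (I X : Type) (h : I -> X -> option bool) :
  crosses_once h -> LD_le (fun f => exists i, f =1 h i) 2.
Proof.
move=> hc d t ht; rewrite leqNgt; apply/negP => d3.
have branch b : exists i, [/\ h i (t [::]) = Some false, h i (t [:: false]) = Some true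
    & h i (t [:: false; true]) = Some b].
  have [|f [[i fi] hf]] := ht [:: false, true, b & nseq (d - 3) false].
    by rewrite /= size_nseq; lia.
  exists i; rewrite -!fi; split; [apply: (hf 0%N) | apply: (hf 1%N) | apply: (hf 2%N)];
    exact: leq_trans d3.
have [i [i0 i1 i2]] := branch false; have [j [j0 j1 j2]] := branch true.
by have := hc i j _ _ i0 i1 j0 j1 (t [:: false; true]); rewrite i2 j2.
Qed.

(** Label every node of depth [k] by the [k]-th point of the shattered set. *)
Lemma VC_ge_LD_ge (X : eqType) (x0 : X) (H : partial_class X) : LD_ge_VC H.
Proof.
move=> d [s [us [ds sh]]]; exists (size s), (fun v => nth x0 s (size v)); split=> // y ys.
have [f [Hf fs]] := sh (fun x => nth false y (index x s)); exists f; split=> // i id.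
have -> : size (take i y) = i by apply: size_takel; rewrite ys ltnW.
by rewrite fs ?index_uniq // mem_nth.
Qed.

(** * Transporting families of concepts to disjoint blocks of one domain *)

Section Blocks.
Variables (N : Type) (V Th : N -> finType).
Variables (c : forall k, Th k -> V k -> option bool).
Variables (X : eqType) (enc : forall k, V k -> X) (dec : forall k, X -> option (V k)).
Hypothesis encK : forall k, pcancel (@enc k) (dec k).
Hypothesis dec_disjoint : forall k k' x, dec k x -> dec k' x -> k = k'.
Hypothesis c_crosses : forall k, crosses_once (@c k).

Definition block_concept (i : {k : N & Th k}) (x : X) : option bool :=
  obind (c (projT2 i)) (dec (projT1 i) x).

Definition block_class : partial_class X := fun f => exists i, f =1 block_concept i.

(** A concept is undefined outside its block, so two concepts defined at a common point have the
    same block index. *)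
Lemma block_class_LD : LD_le block_class 2.
Proof.
apply: crosses_once_LD => -[k th] [k' th'] u v; rewrite /block_concept /=.
case Eu : (dec k u) => [a|//] /= h1; case Ev : (dec k v) => [b|//] /= h2.
case Eu' : (dec k' u) => [a'|//] /= h1'; case Ev' : (dec k' v) => [b'|//] /= h2'.
have kk : k = k' by apply: (@dec_disjoint _ _ u); rewrite ?Eu ?Eu'.
subst k'; move: Eu' Ev'; rewrite Eu Ev => -[aa] [bb]; subst a' b' => x.
by case: (dec k x) => //= y; apply: (c_crosses h1 h2 h1' h2').
Qed.

Lemma block_class_VC (k : N) (d : nat) (Hb : total_class X) :
  (forall G : Th k -> V k -> bool,
    (forall th a b, c th a = Some b -> G th a = b) ->
    exists a : 'I_d -> V k, injective a /\
      forall y : {ffun 'I_d -> bool}, exists th, forall j, G th (a j) = y j) ->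
  disambiguation block_class Hb -> VC_ge (as_partial Hb) d.
Proof.
move=> robust dis.
have /fin_all_exists[g hg] (th : Th k) : exists g, Hb g /\
    forall a b, c th a = Some b -> g (@enc k a) = b.
  pose i : {k : N & Th k} := existT _ k th.
  have bE a : block_concept i (@enc k a) = c th a by rewrite /block_concept /= encK.
  (* The finite set given to the disambiguation is the whole domain of definition of the concept
     within its block. *)
  have [||g [Hg gE]] := dis (block_concept i) _ (map (@enc k) [seq a <- enum (V k) | c th a]).
  - by exists i.
  - move=> x /mapP[a]; rewrite mem_filter => /andP[ca _] ->.
    by rewrite bE; case: (c th a) ca.
  exists g; split=> // a b ab; apply: Some_inj; rewrite -gE ?bE ?ab //.
  by apply/map_f; rewrite mem_filter ab mem_enum.
have [th a b|a [aI ha]] := robust (fun th a => g th (@enc k a)); first exact: (hg th).2.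
have encI : injective (@enc k) := pcan_inj (@encK k).
exists [seq @enc k (a j) | j <- enum 'I_d]; split; [|split].
- by rewrite map_inj_uniq ?enum_uniq // => j j' /encI/aI.
- by rewrite size_map size_enum_ord.
move=> y; have [th hth] := ha [ffun j => y (@enc k (a j))].
exists (fun x => Some (g th x)); split; first by exists (g th); split=> //; exact: (hg th).1.
by move=> x /mapP[j _ ->]; rewrite hth ffunE.
Qed.
End Blocks.

(** * Logarithmic estimates *)

Lemma INR_expn2 m : INR (2 ^ m)%N = pow 2 m.
Proof. by elim: m => [|m IH] //; rewrite expnS mult_INR IH. Qed.

Local Close Scope ring_scope.
Local Open Scope R_scope.

Lemma ln_le (x y : R) : 0 < x -> x <= y -> ln x <= ln y.
Proof.
move=> x0 [xy|->]; last exact: Rle_refl.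
by apply: Rlt_le; apply: ln_increasing.
Qed.

Lemma ln2_le1 : ln 2 <= 1.
Proof.
apply: (Rle_trans _ (ln (exp 1))); last by rewrite ln_exp; apply: Rle_refl.
apply: ln_le; first Lra.lra.
have : 1 <> 0 by Lra.lra.
by move/exp_ineq1; Lra.lra.
Qed.

Lemma ln_pow2_le m : ln (pow 2 m) <= INR m.
Proof.
rewrite ln_pow; last Lra.lra.
rewrite -{2}[INR m]Rmult_1_r; apply: Rmult_le_compat_l; [exact: pos_INR | exact: ln2_le1].
Qed.

(** Each logarithm of a power of 2 is at most its exponent, as [ln 2 <= 1]; this is applied
    twice. *)
Lemma lnln_le (n k : nat) :
  (1 < n)%N -> (n <= 2 ^ (2 ^ k))%N -> ln (ln (INR n)) <= INR k.
Proof.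
move=> n1 nk.
have n1' : 1 < INR n by apply: (lt_INR 1); apply/ssrnat.ltP.
apply: (Rle_trans _ (ln (pow 2 k))); last exact: ln_pow2_le.
apply: ln_le; first by rewrite -ln_1; apply: ln_increasing; Lra.lra.
rewrite -INR_expn2; apply: (Rle_trans _ (ln (pow 2 (2 ^ k)%N))); last exact: ln_pow2_le.
apply: ln_le; first Lra.lra.
by rewrite -INR_expn2; apply/le_INR/ssrnat.leP.
Qed.
Local Close Scope R_scope.

(** * The finite and infinite domains *)

Lemma finite_construction (i n : nat) : (8 <= i)%N -> (2 ^ 2 ^ (10 * i) <= n)%N ->
  exists Hn : partial_class 'I_n, LD_le Hn 2 /\
    forall Hb : total_class 'I_n, disambiguation Hn Hb -> VC_ge (as_partial Hb) i.
Proof.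
move=> i8 hn; set g := (4 ^ i)%N; set t := ((2 * i + 4).+1 * 2)%N.
pose V : finType := {ffun 'I_g * 'I_g * 'I_g -> {ffun 'I_t -> bool}}.
(* Here [#|V| = 2 ^ (t * g ^ 3)] with [g ^ 3 = 2 ^ (6 * i)] and [t <= 2 ^ i <= 2 ^ (4 * i)], whence
   the exponent [10 * i]. *)
have cV : (#|V| <= n)%N.
  apply: leq_trans hn; rewrite !card_ffun card_bool !card_prod !card_ord -expnM leq_exp2l //.
  have -> : (g * g * g = 2 ^ (6 * i))%N by rewrite expnM -!expnMn.
  have -> : (10 * i = 4 * i + 6 * i)%N by rewrite -mulnDl.
  rewrite expnD leq_mul2r; apply/orP; right.
  apply: (@leq_trans (2 ^ i)); last by rewrite leq_exp2l // leq_pmull.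
  by have := linear_lt_exp2 i8; rewrite /t; lia.
pose enc (k : unit) (a : V) : 'I_n := widen_ord cV (enum_rank a).
pose dec (k : unit) (x : 'I_n) : option V := omap enum_val (insub (val x) : option 'I_#|V|).
exists (block_class (fun _ : unit => @concept g t) dec); split.
  apply: block_class_LD => [[] [] //|_]; exact: concept_crosses_once.
move=> Hb; apply: (@block_class_VC _ _ _ _ _ enc dec _ tt).
  by move=> k a; rewrite /dec /= insubT //= => lt; rewrite -[in RHS](enum_rankK a); congr (Some (enum_val _)); apply: val_inj.
exact: concept_dual_vc.
Qed.

(** All sizes [k] live in one class: the code of a point records its block index, which makes the
    blocks disjoint. *)
Lemma infinite_construction :
  exists H : partial_class nat, LD_le H 2 /\
    forall Hb : total_class nat, disambiguation H Hb -> VC_infinite (as_partial Hb).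
Proof.
pose g k := (4 ^ k)%N; pose t k := ((2 * k + 4).+1 * 2)%N.
pose V k : finType := {ffun 'I_(g k) * 'I_(g k) * 'I_(g k) -> {ffun 'I_(t k) -> bool}}.
pose enc k (a : V k) : nat := pickle (k, pickle a).
pose dec k (x : nat) : option (V k) :=
  if unpickle x is Some (k', m) then if k' == k :> nat then unpickle m else None else None.
exists (block_class (fun k => @concept (g k) (t k)) dec); split.
  apply: block_class_LD => [k k' x|k]; last exact: concept_crosses_once.
  rewrite /dec; case: (unpickle x) => [[k0 m]|//].
  by case: eqP => [<-|//] _; case: eqP.
(* The shift by 8 meets the lower bound on [i] in [concept_dual_vc]. *)
move=> Hb dis d; have [||s [us [ds sh]]] := @block_class_VC _ _ _ _ _ enc dec _ (d + 8)%N (d + 8)%N Hb _ dis.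
- by move=> k a; rewrite /dec /enc pickleK eqxx pickleK.
- by apply: concept_dual_vc; rewrite leq_addl.
by exists s; split=> //; split=> //; apply: leq_trans ds; apply: leq_addr.
Qed.

Lemma double_exp_bracket (i0 n : nat) : (2 ^ 2 ^ (10 * i0) <= n)%N ->
  exists i, [/\ (i0 <= i)%N, (2 ^ 2 ^ (10 * i) <= n)%N & (n <= 2 ^ 2 ^ (10 * i.+1))%N].
Proof.
move=> h0.
have bd i : (2 ^ 2 ^ (10 * i) <= n)%N -> (i <= n)%N.
  apply: leq_trans; apply: (@leq_trans (10 * i)); first exact: leq_pmull.
  by apply/ltnW/(@ltn_trans (2 ^ (10 * i))); apply: ltn_expl.
have [i hi imax] := ex_maxnP (ex_intro _ i0 h0) bd.
exists i; split=> //; first exact: imax.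
by rewrite leqNgt; apply/negP => /ltnW/imax; rewrite ltnn.
Qed.

Lemma finite_domain_bound (i0 : nat) : (8 <= i0)%N ->
  exists N : nat, forall n : nat, (N <= n)%N ->
    exists Hn : partial_class 'I_n,
      LD_le Hn 2 /\
      forall Hb : total_class 'I_n, disambiguation Hn Hb ->
        LD_ge_VC (as_partial Hb) /\
        VC_ge_real (as_partial Hb) (Rmult (Rinv 20) (ln (ln (INR n)))).
Proof.
move=> i8; exists (2 ^ 2 ^ (10 * i0))%N => n hn.
have n1 : (1 < n)%N.
  by apply: leq_trans hn; rewrite -{1}(expn0 2) ltn_exp2l // expn_gt0.
have [i [i0i lo hi]] := double_exp_bracket hn.
have [Hn [HL HV]] := finite_construction (leq_trans i8 i0i) lo.
exists Hn; split=> // Hb dis; split; first exact: (VC_ge_LD_ge (Ordinal n1)).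
exists i; split; first exact: HV.
(* From [ln (ln n) <= 10 * i + 10 <= 20 * i] comes the constant [1 / 20]. *)
have := lnln_le n1 hi; have i1 : Rle 1 (INR i).
  by apply: (le_INR 1); apply/ssrnat.leP; apply: leq_trans (leq_trans i8 i0i).
have -> : (10 * i.+1 = 10 * i + 10)%N by rewrite mulnSr.
rewrite -plusE -multE plus_INR mult_INR !INR_IZR_INZ /= in i1 *; Lra.lra.
Qed.

Theorem mainTheorem1 :
  (exists c : R, Rlt 0 c /\
     exists N : nat, forall n : nat, (N <= n)%N ->
       exists Hn : partial_class 'I_n,
         LD_le Hn 2 /\
         forall Hb : total_class 'I_n, disambiguation Hn Hb ->
           LD_ge_VC (as_partial Hb) /\
           VC_ge_real (as_partial Hb) (Rmult c (ln (ln (INR n)))))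
  /\
  (exists Hinf : partial_class nat,
     LD_le Hinf 2 /\
     forall Hb : total_class nat, disambiguation Hinf Hb ->
       LD_ge_VC (as_partial Hb) /\ VC_infinite (as_partial Hb)).
Proof.
split.
  exists (Rinv 20); split; first Lra.lra.
  exact: (@finite_domain_bound 8).
have [H [HL HV]] := infinite_construction.
exists H; split=> // Hb dis; split; [exact: (VC_ge_LD_ge 0%N) | exact: HV].
Qed.
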